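(* Let $Q$ be a groupoid with a right neutral element $1$ and right inverses, that is, $x\cdot 1 = x$ for every $x\in Q$, and for every $x\in Q$ there is $x'\in Q$ with $x\cdot x' = 1$. Suppose that $Q$ satisfies one of the following identities (for all $x,y,z\in Q$): (RB) $x\cdot ((y\cdot z)\cdot y) = ((x\cdot y)\cdot z)\cdot y$; (M1) $((x\cdot y)\cdot x)\cdot z = x\cdot (y\cdot (x\cdot z))$; (M2) $x\cdot (y\cdot (z\cdot y)) = ((x\cdot y)\cdot z)\cdot y$; (C) $x\cdot (y\cdot (y\cdot z)) = ((x\cdot y)\cdot y)\cdot z$. Then $Q$ is a loop.
   Context: A groupoid here is a set with a single binary operation $\cdot$ (no further axioms). A loop is a groupoid with a two-sided neutral element in which every equation $x\cdot y = z$ has a unique solution whenever two of the elements $x,y,z$ are specified; equivalently, there is a two-sided neutral element and all left translations $y\mapsto x\cdot y$ and all right translations $y\mapsto y\cdot x$ are bijections. *)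

(* Defs.v *)
From mathcomp Require Import ssreflect ssrfun ssrbool.

Set Implicit Arguments.

Section Groupoid.

Variables (Q : Type) (op : Q -> Q -> Q).

Local Notation "x * y" := (op x y).

(* Unique solvability of x * y = z in z is automatic, op being a function. *)
Definition is_loop : Prop :=
  (exists e : Q, left_id e op /\ right_id e op) /\
  (forall x z : Q, exists! y : Q, x * y = z) /\
  (forall y z : Q, exists! x : Q, x * y = z).

Definition has_right_inverses (e : Q) : Prop :=
  forall x : Q, exists x' : Q, x * x' = e.

Definition identity_RB : Prop :=
  forall x y z : Q, x * ((y * z) * y) = ((x * y) * z) * y.

Definition identity_M1 : Prop :=
  forall x y z : Q, ((x * y) * x) * z = x * (y * (x * z)).

Definition identity_M2 : Prop :=
  forall x y z : Q, x * (y * (z * y)) = ((x * y) * z) * y.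

Definition identity_C : Prop :=
  forall x y z : Q, x * (y * (y * z)) = ((x * y) * y) * z.

End Groupoid.

(* Main.v *)
Require Import Defs.
From mathcomp Require Import ssreflect ssrfun ssrbool.

Set Implicit Arguments.

(** Write [R_y] for the right translation [x |-> x * y].  A right neutral
    element and right inverses are weak: a priori [e * x] may differ from [x],
    an inverse may not be inverted back, and no translation need be injective.
    The work is to show that each identity repairs this; division is then given
    by explicit formulas.

    (RB) and (M2) are treated together.  Both make [R_y R_z R_y] a right
    translation again.  The lemma [bol_like_loop] isolates what they share: the
    Bol-like law [x * (((e * y) * z) * y) = ((x * y) * z) * y], which becomes
    (RB) as soon as [e] is left neutral, and the equation
    [((x * y) * y') * y = x * y] for [y * y' = e].  The key point is that every
    [y] has a right inverse [b] which itself has a two-sided inverse [a]; then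
    [R_b], [R_(a * a)], [R_b] compose to the identity, so [R_b] is bijective
    ([right_inverse_property]).  Cancelling [b] in [y * b = e = a * b]
    identifies [y] with [a], and everything else follows.

    (M1) implies flexibility, which quickly makes [e] two-sided and inverses
    two-sided.  The opposite operation then satisfies (M2) and the previous case
    applies, the loop property being self-dual.

    (C) gives [(u * s) * t = u] whenever [s * t = e] and [s] is a right inverse
    of something ([C_right_cancel]).  Along a chain of iterated right inverses
    this forces [y'' = y] and [e * y = y]. *)

Section Loops.

Variables (Q : Type) (op : Q -> Q -> Q) (e : Q).

Local Notation "x * y" := (op x y).

Lemma is_loop_of_divisions :
  left_id e op -> right_id e op ->
  (forall x z, exists y, x * y = z) -> (forall x, injective (op x)) ->
  (forall y z, exists x, x * y = z) -> (forall y, injective (op^~ y)) ->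
  is_loop op.
Proof.
move=> e1 e2 ldiv linj rdiv rinj; split; first by exists e.
split=> [x z|y z].
  have [y xy] := ldiv x z; exists y; split=> // y' xy'.
  by apply: (linj x); rewrite xy xy'.
have [x xy] := rdiv y z; exists x; split=> // x' x'y.
by apply: (rinj y); rewrite /= xy x'y.
Qed.

Lemma is_loop_opposite : is_loop (fun x y => y * x) -> is_loop op.
Proof.
by move=> [[f [f1 f2]] [ldiv rdiv]]; split; [exists f | split=> a b].
Qed.

Hypothesis mule : right_id e op.
Hypothesis right_inv : has_right_inverses op e.

(** * The identities (RB) and (M2) *)

Section BolLike.

Hypothesis bol_like : forall x y z, x * (((e * y) * z) * y) = ((x * y) * z) * y.
Hypothesis regular : forall x y y', y * y' = e -> ((x * y) * y') * y = x * y.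

Lemma mul_emul x y : x * (e * y) = x * y.
Proof. by have := bol_like x e y; rewrite !mule. Qed.

(** A right inverse [b] of [y], and a right inverse [a] of [b], may be replaced
    by their products with [e].  Then [a] and [b] are mutually inverse and
    [(b * (a * a)) * b = e], so that the Bol-like law at [b] and [a * a] reads
    [R_b R_(a * a) R_b = id]: this makes [R_b] bijective with inverse [R_a].
    Cancelling [b] in [y * b = e = a * b] then gives [y = a]. *)
Lemma right_inverse_property y :
  e * y = y /\ exists b, (forall x, (x * y) * b = x) /\ (forall x, (x * b) * y = x).
Proof.
have [s ys] := right_inv y.
have yb : y * (e * s) = e by rewrite mul_emul.
have eb : e * (e * s) = e * s by rewrite mul_emul.
move: (e * s) yb eb => b yb eb.
have [t bt] := right_inv b.
have ab : (e * t) * b = e by have := regular y bt; rewrite yb.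
have ba : b * (e * t) = e by rewrite mul_emul.
have ea : e * (e * t) = e * t by rewrite mul_emul.
move: (e * t) ab ba ea => a ab ba ea.
have sqr x : x * (a * a) = (x * a) * a.
  by have := bol_like x a e; rewrite !mule ea.
have inv x : ((x * b) * (a * a)) * b = x.
  by have := bol_like x b (a * a); rewrite eb (sqr b) ba ea ab mule.
have inj : injective (op^~ b).
  by move=> x1 x2 /= E; rewrite -(inv x1) -(inv x2) E.
have bK x : (x * b) * a = x by apply: inj; apply: regular.
have ya : y = a by apply: inj; rewrite /= yb ab.
rewrite ya; split=> //; exists b; split=> // x.
by rewrite -(inv x) bK.
Qed.

Lemma left_neutral_of_bol_like : left_id e op.
Proof. by move=> y; have [] := right_inverse_property y. Qed.

(** With [b] the inverse of [x], the law reads [R_x R_v R_x = R_((x * v) * x)];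
    hence [x * v = z] means [R_v = R_b R_(z * x) R_b], which suggests the
    solution [v = (b * (z * x)) * b]. *)
Lemma bol_like_loop : is_loop op.
Proof.
have eop := left_neutral_of_bol_like.
have bol x y z : x * ((y * z) * y) = ((x * y) * z) * y.
  by rewrite -bol_like eop.
apply: is_loop_of_divisions => //.
- move=> x z; have [_ [b [xK bK]]] := right_inverse_property x.
  have xb : x * b = e by have := xK e; rewrite eop.
  by exists ((b * (z * x)) * b); rewrite bol xb eop xK.
- move=> x; have [_ [b [xK bK]]] := right_inverse_property x.
  have bx : b * x = e by have := bK e; rewrite eop.
  have solve v : (b * ((x * v) * x)) * b = v by rewrite bol bx eop xK.
  by move=> v1 v2 E; rewrite -(solve v1) -(solve v2) E.
- move=> y z; have [_ [b [_ bK]]] := right_inverse_property y.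
  by exists (z * b).
- move=> y; have [_ [b [yK _]]] := right_inverse_property y.
  exact: (@can_inj _ _ _ (op^~ b)) yK.
Qed.

End BolLike.

Lemma RB_loop : identity_RB op -> is_loop op.
Proof.
move=> RB.
have emul x z : x * (e * z) = x * z by have := RB x e z; rewrite !mule.
apply: bol_like_loop => [x y z|x y y' yy'].
  by rewrite -!RB emul.
by rewrite -RB yy' emul.
Qed.

Lemma M2_loop : identity_M2 op -> is_loop op.
Proof.
move=> M2.
have emul x z : x * (e * z) = x * z by have := M2 x e z; rewrite !mule.
apply: bol_like_loop => [x y z|x y y' yy'].
  by rewrite -!M2 emul.
have ey' : (e * y) * y' = e.
  by have := M2 y y' y; rewrite yy' mule yy'.
(* Both [y * (y' * y)] and [y] act on the right as their common product with
   [e] on the left. *)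
by rewrite -M2 -emul M2 ey' emul.
Qed.

(** * The identity (M1) *)

(** Flexibility and [x * x' = e] give [x' * (x * (x' * z)) = x' * z]; taking
    [z = x''] yields [x' * x = e], and then [x = x * (x' * x) = e * x].  With
    [e] and inverses two-sided, (M1) is (M2) for the opposite operation. *)
Lemma M1_left_neutral_inverses :
  identity_M1 op -> left_id e op /\ forall x x', x * x' = e -> x' * x = e.
Proof.
move=> M1.
have flex x y : (x * y) * x = x * (y * x) by have := M1 x y e; rewrite !mule.
have linv x x' : x * x' = e -> x' * x = e.
  move=> xx'; have [x'' x'x''] := right_inv x'.
  by have := M1 x' x x''; rewrite flex xx' mule x'x'' mule => <-.
split=> // x; have [x' xx'] := right_inv x.
by rewrite -xx' flex (linv _ _ xx') mule.
Qed.

(** * The identity (C) *)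

Section IdentityC.

Hypothesis C : identity_C op.

Lemma C_mul_emul2 x z : x * (e * (e * z)) = x * z.
Proof. by have := C x e z; rewrite !mule. Qed.

Lemma C_mul_sqr x y : x * (y * y) = (x * y) * y.
Proof. by have := C x y e; rewrite !mule. Qed.

Lemma C_regular x y y' : y * y' = e -> ((x * y) * y) * y' = x * y.
Proof. by move=> yy'; rewrite -C yy' mule. Qed.

(** Regularity gives [(((e * s) * s) * t) * t = e], that is
    [e * (s * (s * (t * t))) = e].  As [u * w] depends only on [e * w], also
    [u * (s * (s * (t * t))) = u], whose left side is [(u * s) * t], again
    by regularity. *)
Lemma C_right_cancel x s t u : x * s = e -> s * t = e -> (u * s) * t = u.
Proof.
move=> xs st.
have est : (e * s) * t = e by have := C_regular x st; rewrite xs.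
have sstt w : w * (s * (s * (t * t))) = (w * s) * t.
  by rewrite C C_mul_sqr C_regular.
by rewrite -sstt -C_mul_emul2 sstt est !mule.
Qed.

(** Along [y, x, s, t, r], each a right inverse of the one before, [R_t] is
    injective, and [y * t = e = s * t]; hence [y = s = y'']. *)
Lemma C_left_neutral_inverses y : e * y = y /\ exists2 x, y * x = e & x * y = e.
Proof.
have [x yx] := right_inv y; have [s xs] := right_inv x.
have [t st] := right_inv s; have [r tr] := right_inv t.
have es : e * s = y by have := C_right_cancel y yx xs; rewrite yx.
have yt : y * t = e by rewrite -es; exact: C_right_cancel xs st.
have ys : y = s.
  by rewrite -(C_right_cancel y st tr) yt -st (C_right_cancel s st tr).
by split; [rewrite {1}ys | exists x => //; rewrite ys].
Qed.

(** For [x] and [y] mutually inverse, (C) with first factor [x * x] shows that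
    [x * (x * (y * (y * z))) = z], so left translations are bijective. *)
Lemma C_loop : is_loop op.
Proof.
have eop : left_id e op by move=> y; have [] := C_left_neutral_inverses y.
have lK x y z : x * y = e -> y * x = e -> x * (x * (y * (y * z))) = z.
  move=> xy yx; have sqr w : x * (x * w) = (x * x) * w.
    by have := C e x w; rewrite !eop.
  by rewrite sqr C -C_mul_sqr -sqr C_mul_sqr xy eop xy eop.
apply: is_loop_of_divisions => //.
- move=> x z; have [_ [y xy yx]] := C_left_neutral_inverses x.
  by exists (x * (y * (y * z))); apply: lK.
- move=> x v1 v2 E; have [_ [y xy yx]] := C_left_neutral_inverses x.
  by rewrite -(lK y x v1) // -(lK y x v2) // E.
- move=> y z; have [_ [x yx xy]] := C_left_neutral_inverses y.
  by exists (z * x); apply: C_right_cancel yx xy.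
- move=> y; have [_ [x yx xy]] := C_left_neutral_inverses y.
  by apply: (@can_inj _ _ _ (op^~ x)) => u; apply: C_right_cancel xy yx.
Qed.

End IdentityC.

End Loops.

Lemma M1_loop (Q : Type) (op : Q -> Q -> Q) (e : Q) :
  right_id e op -> has_right_inverses op e -> identity_M1 op -> is_loop op.
Proof.
move=> mule right_inv M1.
have [eop linv] := M1_left_neutral_inverses mule right_inv M1.
apply: is_loop_opposite; apply: (@M2_loop _ _ e).
- exact: eop.
- by move=> x; have [x' xx'] := right_inv x; exists x'; apply: linv.
- by move=> x y z; exact: M1.
Qed.

Theorem corollary6p3 (Q : Type) (op : Q -> Q -> Q) (e : Q)
  (right_neutral : right_id e op)
  (right_inverses : has_right_inverses op e)
  (identities : identity_RB op \/ identity_M1 op \/ identity_M2 op \/ identity_C op) :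
  is_loop op.
Proof.
case: identities => [RB|[M1|[M2|C]]].
- exact: RB_loop RB.
- exact: M1_loop M1.
- exact: M2_loop M2.
- exact: C_loop C.
Qed.
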